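(* Let $n\ge 2$. For a set $\mathcal{I}\subseteq\{k,i,c,\wedge,\vee\}$ of operations, a topological space $X$ and subsets $E_1,\dots,E_n\subseteq X$, let $G_{\mathcal{I}}(X;E_1,\dots,E_n)$ be the family of subsets of $X$ that can be obtained from $E_1,\dots,E_n$ by finitely many (possibly zero) successive applications of the operations in $\mathcal{I}$, i.e. the smallest family of subsets of $X$ that contains $E_1,\dots,E_n$ and is closed under the operations in $\mathcal{I}$. Let $M_n(\mathcal{I})$ be the maximum of $|G_{\mathcal{I}}(X;E_1,\dots,E_n)|$ over all topological spaces $X$ and all $E_1,\dots,E_n\subseteq X$, where $M_n(\mathcal{I})=\infty$ means that $G_{\mathcal{I}}(X;E_1,\dots,E_n)$ is infinite for some choice of $X$ and $E_1,\dots,E_n$. Let $\mathcal{F}_n$ be the free closure algebra on $n$ generators, and let $(\mathcal{I})_{\mathcal{F}_n}$ be the smallest subset of $\mathcal{F}_n$ containing the $n$ generators and closed under the operations in $\mathcal{I}$. Then for every $\mathcal{I}\subseteq\{k,i,c,\wedge,\vee\}$ one has $M_n(\mathcal{I})=|(\mathcal{I})_{\mathcal{F}_n}|$ (with $\infty$ meaning infinite cardinality), and, writing $\mathcal{I}=U\cup B$ with $U\subseteq\{k,i,c\}$ and $B\subseteq\{\wedge,\vee\}$, the value is as follows, where the four entries in each row correspond to $B=\emptyset$, $B=\{\wedge\}$, $B=\{\vee\}$, $B=\{\wedge,\vee\}$ in this order: \begin{itemize} \item $U=\emptyset$: $n,\ 2^n-1,\ 2^n-1,\ D_n$; \item $U=\{i\}$: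 $2n,\ 3^n-1,\ \infty,\ \infty$; \item $U=\{k\}$: $2n,\ \infty,\ 3^n-1,\ \infty$; \item $U=\{c\}$: $2n,\ 2^{2^n},\ 2^{2^n},\ 2^{2^n}$; \item $U=\{i,k\}$: $7n,\ \infty,\ \infty,\ \infty$; \item $U=\{i,c\}$, $U=\{k,c\}$, or $U=\{i,k,c\}$: $14n,\ \infty,\ \infty,\ \infty$. \end{itemize} Here $D_n$ denotes the cardinality of the free distributive lattice on $n$ generators.
   Context: For a topological space $X$, the operations on subsets of $X$ are: $k$ = topological closure, $i$ = topological interior, $c$ = set complement in $X$ (unary operations), and $\wedge$ = intersection of two sets, $\vee$ = union of two sets (binary operations). A closure algebra is a Boolean lattice (complemented distributive lattice) with join $\vee$, meet $\wedge$, complement $c$, least element $0$ and greatest element $1$, equipped with a unary operation $k$ satisfying $k0=0$, $kkx=kx$, $kx\ge x$, and $kx\vee ky=k(x\vee y)$ for all $x,y$; one sets $i=ckc$. The power set of a topological space is a closure algebra with the operations above. The free closure algebra on $n$ generators $\mathcal{F}_n$ is the free object on $n$ generators in the class of all closure algebras (generators $F_1,\dots,F_n$ such that for each closure algebra $A$ and all $a_1,\dots,a_n\in A$ there is a unique homomorphism of closure algebras $\mathcal{F}_n\to A$ sending each $F_j$ to $a_j$). The free distributive lattice on $n$ generators is taken in the signature $\{\wedge,\vee\}$ only: empty meets and empty joins are not admitted, so no least or greatest element is adjoined as a constant (e.g. $D_1=1$, $D_2=4$). *)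

(* Defs.v *)
From HB Require Import structures.
From mathcomp Require Import all_boot all_order finmap.
From mathcomp Require Import boolp classical_sets functions cardinality topology.

Set Implicit Arguments.
Unset Strict Implicit.
Unset Printing Implicit Defensive.

Import Order.Theory.

Local Open Scope classical_set_scope.

(** Cardinality of a set, with [None] standing for "infinite". *)
Definition card_or_inf (T : choiceType) (A : set T) : option nat :=
  if `[< finite_set A >] then Some #|` fset_set A | else None.

Variant operation := opK | opI | opC | opMeet | opJoin.

Definition op_closed (T : Type) (k i c : T -> T) (meet join : T -> T -> T)
    (I : set operation) (S : set T) : Prop :=
  [/\ I opK -> forall x, S x -> S (k x),
      I opI -> forall x, S x -> S (i x),
      I opC -> forall x, S x -> S (c x),
      I opMeet -> forall x y, S x -> S y -> S (meet x y) &
      I opJoin -> forall x y, S x -> S y -> S (join x y)].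

(** ** Topological spaces *)

Definition space_generated (I : set operation) (X : topologicalType) (n : nat)
    (E : 'I_n -> set X) : set (set X) :=
  smallest (op_closed (@closure X) (@interior X) setC setI setU I) (range E).

(** [max_generated n I v] reads "M_n(I) = v".  For finite [v] the maximum is attained
    and no family of generated sets is larger, let alone infinite. *)
Definition max_generated (n : nat) (I : set operation) (v : option nat) : Prop :=
  if v is Some m then
    (exists (X : topologicalType) (E : 'I_n -> set X),
        card_or_inf (space_generated I E) = Some m) /\
    (forall (X : topologicalType) (E : 'I_n -> set X),
        exists2 p, card_or_inf (space_generated I E) = Some p & (p <= m)%N)
  else
    exists (X : topologicalType) (E : 'I_n -> set X),
      card_or_inf (space_generated I E) = None.

(** [max_generated_row n U v1 v2 v3 v4] gives M_n(U \cup B) for the four subsets B of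
    {meet, join}. *)
Definition max_generated_row (n : nat) (U : set operation) (v1 v2 v3 v4 : option nat) : Prop :=
  [/\ max_generated n (U `|` set0) v1,
      max_generated n (U `|` [set opMeet]) v2,
      max_generated n (U `|` [set opJoin]) v3 &
      max_generated n (U `|` [set opMeet; opJoin]) v4].

(** ** Closure algebras *)

HB.mixin Record hasClosure d T of Order.CTBDistrLattice d T := {
  clos : T -> T;
  clos0 : clos (Order.bottom : T) = (Order.bottom : T);
  closK : forall x : T, clos (clos x) = clos x;
  le_clos : forall x : T, Order.le x (clos x);
  closU : forall x y : T,
    Order.join (clos x) (clos y) = clos (Order.join x y)
}.

#[short(type="closureAlgebraType")]
HB.structure Definition ClosureAlgebra d :=
  { T of Order.CTBDistrLattice d T & hasClosure d T }.

Definition inter {d} {A : closureAlgebraType d} (x : A) : A :=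
  Order.compl (clos (Order.compl x)).

Definition closure_algebra_hom d (A : closureAlgebraType d)
    d' (B : closureAlgebraType d') (f : A -> B) : Prop :=
  [/\ Order.meet_morphism f /\ Order.join_morphism f,
      f Order.bottom = Order.bottom /\ f Order.top = Order.top,
      (forall x, f (Order.compl x) = Order.compl (f x)) &
      forall x, f (clos x) = clos (f x)].

Definition free_closure_algebra (n : nat) d (F : closureAlgebraType d)
    (g : 'I_n -> F) : Prop :=
  forall d' (A : closureAlgebraType d') (a : 'I_n -> A),
    exists! f : F -> A, closure_algebra_hom f /\ forall j, f (g j) = a j.

Definition algebra_generated (I : set operation) d (F : closureAlgebraType d) (n : nat)
    (g : 'I_n -> F) : set F :=
  smallest
    (op_closed (@clos d F) inter (@Order.compl d F) (@Order.meet d F)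
       (@Order.join d F) I)
    (range g).

(** ** Free distributive lattices *)

(** Bounds play no role: a [distrLatticeType] need not have any, and morphisms
    are only required to commute with meet and join. *)
Definition free_distr_lattice (n : nat) d (L : distrLatticeType d)
    (g : 'I_n -> L) : Prop :=
  forall d' (A : distrLatticeType d') (a : 'I_n -> A),
    exists! f : L -> A,
      [/\ Order.meet_morphism f, Order.join_morphism f & forall j, f (g j) = a j].

(** ** Existence of the free objects

    Terms are identified when they take the same value in every algebra under
    every valuation. *)

Module FreeClosureAlgebra.
Section Free.
Variable n : nat.

Inductive term :=
  | Var of 'I_n | Bot | Top
  | Meet of term & term | Join of term & term | Compl of term | Clos of term.

Fixpoint eval d (A : closureAlgebraType d) (a : 'I_n -> A) (t : term) : A :=
  match t with
  | Var j => a j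
  | Bot => Order.bottom
  | Top => Order.top
  | Meet s t => Order.meet (eval a s) (eval a t)
  | Join s t => Order.join (eval a s) (eval a t)
  | Compl t => Order.compl (eval a t)
  | Clos t => clos (eval a t)
  end.

Definition equiv (s t : term) : Prop :=
  forall d (A : closureAlgebraType d) (a : 'I_n -> A), eval a s = eval a t.

Definition cls (t : term) : set term := equiv t.

Definition F := {c : set term | `[< exists t, c = cls t >]}.

HB.instance Definition _ := Choice.copy F {c : set term | `[< exists t, c = cls t >]}.

Definition pi (t : term) : F :=
  exist _ (cls t) (introT (asboolP _) (ex_intro _ t erefl)).

Lemma piP (x : F) : exists t, pi t = x.
Proof.
case: x => c cP; have /asboolP[t ct] := cP; exists t.
by apply: val_inj; rewrite /= ct.
Qed.

Definition repr (x : F) : term := projT1 (cid (piP x)).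

Lemma reprK x : pi (repr x) = x.
Proof. exact: projT2 (cid (piP x)). Qed.

Lemma eq_pi s t : equiv s t <-> pi s = pi t.
Proof.
split=> [st|[e]]; last by rewrite -/(cls s t) e.
apply: val_inj; rewrite /= predeqE => u; split=> h d A a.
  by rewrite -st h.
by rewrite st h.
Qed.

Lemma repr_pi t : equiv (repr (pi t)) t.
Proof. by apply/eq_pi; rewrite reprK. Qed.

Definition meet (x y : F) := pi (Meet (repr x) (repr y)).
Definition join (x y : F) := pi (Join (repr x) (repr y)).
Definition compl (x : F) := pi (Compl (repr x)).
Definition cl (x : F) := pi (Clos (repr x)).

Lemma meetE s t : meet (pi s) (pi t) = pi (Meet s t).
Proof. by apply/eq_pi => d A a /=; rewrite !(repr_pi _ a). Qed.
Lemma joinE s t : join (pi s) (pi t) = pi (Join s t).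
Proof. by apply/eq_pi => d A a /=; rewrite !(repr_pi _ a). Qed.
Lemma complE t : compl (pi t) = pi (Compl t).
Proof. by apply/eq_pi => d A a /=; rewrite !(repr_pi _ a). Qed.
Lemma clE t : cl (pi t) = pi (Clos t).
Proof. by apply/eq_pi => d A a /=; rewrite !(repr_pi _ a). Qed.

Definition le (x y : F) := meet x y == x.
Definition lt (x y : F) := (y != x) && le x y.

Ltac by_terms := repeat (let x := fresh "x" in move=> x; case: (piP x) => ? <-);
  rewrite ?(meetE, joinE, complE, clE); apply/eq_pi => d A a /=.

Lemma FmeetC : commutative meet. Proof. by by_terms; rewrite meetC. Qed.
Lemma FjoinC : commutative join. Proof. by by_terms; rewrite joinC. Qed.
Lemma FmeetA : associative meet. Proof. by by_terms; rewrite meetA. Qed.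
Lemma FjoinA : associative join. Proof. by by_terms; rewrite joinA. Qed.
Lemma FjoinKI y x : meet x (join x y) = x.
Proof. by move: y x; by_terms; rewrite joinKI. Qed.
Lemma FmeetKU y x : join x (meet x y) = x.
Proof. by move: y x; by_terms; rewrite meetKU. Qed.
Lemma FmeetUl : left_distributive meet join.
Proof. by by_terms; rewrite meetUl. Qed.
Lemma Fmeetxx : idempotent_op meet. Proof. by by_terms; rewrite meetxx. Qed.

Fact display : Order.disp_t. Proof. by []. Qed.

HB.instance Definition _ := @Order.isMeetJoinDistrLattice.Build display F
  le lt meet join (fun _ _ => erefl) (fun _ _ => erefl)
  FmeetC FjoinC FmeetA FjoinA FjoinKI FmeetKU FmeetUl Fmeetxx.

Lemma meetF (x y : F) : Order.meet x y = meet x y. Proof. by []. Qed.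
Lemma joinF (x y : F) : Order.join x y = join x y. Proof. by []. Qed.

Lemma le0x (x : F) : Order.le (pi Bot) x.
Proof.
by rewrite leEmeet meetF; apply/eqP; move: x; by_terms; rewrite meet0x.
Qed.
Lemma lex1 (x : F) : Order.le x (pi Top).
Proof.
by rewrite leEmeet meetF; apply/eqP; move: x; by_terms; rewrite meetx1.
Qed.

HB.instance Definition _ := @Order.hasBottom.Build display F (pi Bot) le0x.
HB.instance Definition _ := @Order.hasTop.Build display F (pi Top) lex1.

Lemma FjoinxC (x : F) : Order.join x (compl x) = Order.top.
Proof. by rewrite joinF; move: x; by_terms; rewrite joinxC. Qed.
Lemma FmeetxC (x : F) : Order.meet x (compl x) = Order.bottom.
Proof. by rewrite meetF; move: x; by_terms; rewrite meetxC. Qed.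

HB.instance Definition _ :=
  @Order.TBDistrLattice_hasComplement.Build display F compl FjoinxC FmeetxC.

Lemma cl0 : cl (Order.bottom : F) = Order.bottom.
Proof. by rewrite [LHS]clE; apply/eq_pi => d A a /=; rewrite clos0. Qed.
Lemma clK (x : F) : cl (cl x) = cl x.
Proof. by move: x; by_terms; rewrite closK. Qed.
Lemma le_cl (x : F) : Order.le x (cl x).
Proof.
rewrite leEmeet meetF; apply/eqP; move: x; by_terms.
by apply/eqP; rewrite -leEmeet le_clos.
Qed.
Lemma clU (x y : F) : Order.join (cl x) (cl y) = cl (Order.join x y).
Proof. by rewrite !joinF; move: x y; by_terms; rewrite closU. Qed.

HB.instance Definition _ := @hasClosure.Build display F cl cl0 clK le_cl clU.

Lemma free : free_closure_algebra (fun j => pi (Var j)).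
Proof.
move=> d' A a; exists (fun x => eval a (repr x)); split.
  have h t : eval a (repr (pi t)) = eval a t by exact: repr_pi.
  by split=> [|j]; [split=> [||x|x]; [split=> x y|split|..]|]; rewrite h.
move=> f [[[fM fJ] [f0 f1] fc fk] fg]; apply/funext => x.
rewrite -[in RHS](reprK x); elim: (repr x) => //=.
- by move=> s -> t ->; rewrite -[pi (Meet s t)]meetE [RHS]fM.
- by move=> s -> t ->; rewrite -[pi (Join s t)]joinE [RHS]fJ.
- by move=> t ->; rewrite -[pi (Compl t)]complE [RHS]fc.
- by move=> t ->; rewrite -[pi (Clos t)]clE [RHS]fk.
Qed.

End Free.
End FreeClosureAlgebra.

Lemma free_closure_algebra_exists (n : nat) :
  exists d (F : closureAlgebraType d) (g : 'I_n -> F), free_closure_algebra g.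
Proof. by do 3!eexists; apply: FreeClosureAlgebra.free. Qed.

Module FreeDistrLattice.
Section Free.
Variable n : nat.

Inductive term :=
  | Var of 'I_n | Meet of term & term | Join of term & term.

Fixpoint eval d (A : distrLatticeType d) (a : 'I_n -> A) (t : term) : A :=
  match t with
  | Var j => a j
  | Meet s t => Order.meet (eval a s) (eval a t)
  | Join s t => Order.join (eval a s) (eval a t)
  end.

Definition equiv (s t : term) : Prop :=
  forall d (A : distrLatticeType d) (a : 'I_n -> A), eval a s = eval a t.

Definition cls (t : term) : set term := equiv t.

Definition L := {c : set term | `[< exists t, c = cls t >]}.

HB.instance Definition _ := Choice.copy L {c : set term | `[< exists t, c = cls t >]}.

Definition pi (t : term) : L :=
  exist _ (cls t) (introT (asboolP _) (ex_intro _ t erefl)).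

Lemma piP (x : L) : exists t, pi t = x.
Proof.
case: x => c cP; have /asboolP[t ct] := cP; exists t.
by apply: val_inj; rewrite /= ct.
Qed.

Definition repr (x : L) : term := projT1 (cid (piP x)).

Lemma reprK x : pi (repr x) = x.
Proof. exact: projT2 (cid (piP x)). Qed.

Lemma eq_pi s t : equiv s t <-> pi s = pi t.
Proof.
split=> [st|[e]]; last by rewrite -/(cls s t) e.
apply: val_inj; rewrite /= predeqE => u; split=> h d A a.
  by rewrite -st h.
by rewrite st h.
Qed.

Lemma repr_pi t : equiv (repr (pi t)) t.
Proof. by apply/eq_pi; rewrite reprK. Qed.

Definition meet (x y : L) := pi (Meet (repr x) (repr y)).
Definition join (x y : L) := pi (Join (repr x) (repr y)).

Lemma meetE s t : meet (pi s) (pi t) = pi (Meet s t).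
Proof. by apply/eq_pi => d A a /=; rewrite !(repr_pi _ a). Qed.
Lemma joinE s t : join (pi s) (pi t) = pi (Join s t).
Proof. by apply/eq_pi => d A a /=; rewrite !(repr_pi _ a). Qed.

Definition le (x y : L) := meet x y == x.
Definition lt (x y : L) := (y != x) && le x y.

Ltac by_terms := repeat (let x := fresh "x" in move=> x; case: (piP x) => ? <-);
  rewrite ?(meetE, joinE); apply/eq_pi => d A a /=.

Lemma FmeetC : commutative meet. Proof. by by_terms; rewrite meetC. Qed.
Lemma FjoinC : commutative join. Proof. by by_terms; rewrite joinC. Qed.
Lemma FmeetA : associative meet. Proof. by by_terms; rewrite meetA. Qed.
Lemma FjoinA : associative join. Proof. by by_terms; rewrite joinA. Qed.
Lemma FjoinKI y x : meet x (join x y) = x.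
Proof. by move: y x; by_terms; rewrite joinKI. Qed.
Lemma FmeetKU y x : join x (meet x y) = x.
Proof. by move: y x; by_terms; rewrite meetKU. Qed.
Lemma FmeetUl : left_distributive meet join.
Proof. by by_terms; rewrite meetUl. Qed.
Lemma Fmeetxx : idempotent_op meet. Proof. by by_terms; rewrite meetxx. Qed.

Fact display : Order.disp_t. Proof. by []. Qed.

HB.instance Definition _ := @Order.isMeetJoinDistrLattice.Build display L
  le lt meet join (fun _ _ => erefl) (fun _ _ => erefl)
  FmeetC FjoinC FmeetA FjoinA FjoinKI FmeetKU FmeetUl Fmeetxx.

Lemma free : free_distr_lattice (fun j => pi (Var j)).
Proof.
move=> d' A a; exists (fun x => eval a (repr x)); split.
  have h t : eval a (repr (pi t)) = eval a t by exact: repr_pi.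
  by split=> [x y|x y|j]; rewrite h.
move=> f [fM fJ fg]; apply/funext => x.
rewrite -[in RHS](reprK x); elim: (repr x) => //=.
- by move=> s -> t ->; rewrite -[pi (Meet s t)]meetE [RHS]fM.
- by move=> s -> t ->; rewrite -[pi (Join s t)]joinE [RHS]fJ.
Qed.

End Free.
End FreeDistrLattice.

Lemma free_distr_lattice_exists (n : nat) :
  exists d (L : distrLatticeType d) (g : 'I_n -> L), free_distr_lattice g.
Proof. by do 3!eexists; apply: FreeDistrLattice.free. Qed.

(* Main.v *)
Require Import Defs.
From HB Require Import structures.
From mathcomp Require Import all_boot all_order finmap.
From mathcomp Require Import boolp classical_sets functions cardinality topology.
Local Open Scope classical_set_scope.

Set Implicit Arguments.
Unset Strict Implicit.
Unset Printing Implicit Defensive.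

Import Order.Theory.

(** Two facts reduce everything to computations in well-chosen spaces.

    The first is that a maximum is witnessed by a parametrization. Suppose that in every
    space the generated family consists of the values [f t] of expressions [t] ranging over
    one fixed set [A], and that in a single space different [t] have different values.
    Then the maximum is the cardinality of [A], finite or not ([max_generated_by]). With
    [A] the family generated in a free closure algebra and [f] the homomorphism given by
    freeness this is the general equality ([max_generated_free]): the separating space is
    the Stone representation, whose points are the ultrafilters and whose basic open sets
    are those of the open elements of the algebra ([stone_set_hom], [stone_set_inj]).

    The second is that complementation exchanges closure with interior and meet with join
    ([max_generated_dual]), and that closing under complements brings in the duals of all
    operations ([max_generated_complement]). So few rows are left.

    - Without meet and join the expressions are the words of Kuratowski's theorem applied
      to one generator. A space made of one copy of a nine-point space for each generator
      separates them, which is checked by evaluation ([max_generated_unary]).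
    - With meets alone, or meets and interiors, the expressions are nonempty meets of
      generators and interiors of generators, because interior commutes with finite meets
      ([max_generated_meet], [max_generated_i_meet]).
    - With complement and meet the expressions are sets of atoms
      ([max_generated_boolean]).
    - With meet and join they are the elements of the free distributive lattice, which truth
      assignments separate ([truth_le], [max_generated_lattice]).
    - With closure and meet two generators already produce infinitely many sets: in the
      natural numbers with the up-closed sets as closed sets, closing and meeting alternately
      with the even and the odd numbers yields ever smaller tails
      ([max_generated_infinite]). *)

(** * Generated families *)

Notation space_closed I S :=
  (op_closed (@closure _) (@interior _) setC setI setU I S).

Lemma smallest_op_closed (T : Type) (k i c : T -> T) (meet join : T -> T -> T)
    (I : set operation) (G : set T) :
  op_closed k i c meet join I (smallest (op_closed k i c meet join I) G).
Proof.
by split=> IO x => [Gx|Gx|Gx|y Gx Gy|y Gx Gy] S [cS GS];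
  (have {}Gx : S x by exact: Gx); try (have {}Gy : S y by exact: Gy);
  case: cS => ? ? ? ? ?; auto.
Qed.

Section Generated.
Variables (I : set operation) (X : topologicalType) (n : nat) (E : 'I_n -> set X).

Lemma generated_op_closed : space_closed I (space_generated I E).
Proof. exact: smallest_op_closed. Qed.

Lemma generator_generated j : space_generated I E (E j).
Proof. by move=> S [_]; apply; exists j. Qed.

(** The parametrized family is closed, so minimality puts the generated family inside it. *)
Lemma space_generatedE (T : Type) (A : set T) (f : T -> set X) :
  space_closed I (f @` A) -> (forall j, (f @` A) (E j)) ->
  (forall t, A t -> space_generated I E (f t)) ->
  space_generated I E = f @` A.
Proof.
move=> fcl fE fG; rewrite eqEsubset; split; last by move=> _ [t At <-]; exact: fG.
by apply: smallest_sub => // _ [j _ <-].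
Qed.

End Generated.

Lemma card_or_inf_eq (T U : choiceType) (A : set T) (B : set U) :
  (A #= B)%card -> card_or_inf A = card_or_inf B.
Proof.
move=> AB; rewrite /card_or_inf (eq_finite_set AB).
case: asboolP => // Bf; congr Some; apply/(fcard_eq _ Bf) => //.
by rewrite (eq_finite_set AB).
Qed.

Lemma card_or_inf_pred (T : finType) (P : pred T) :
  card_or_inf [set t | P t] = Some #|P|.
Proof.
rewrite /card_or_inf asboolT; last exact: finite_finset.
have -> : [set t | P t] = [set` [fset t in enum P]%fset].
  by apply/seteqP; split=> t; rewrite /= inE /= mem_enum.
by rewrite set_fsetK card_fseq undup_id ?enum_uniq// cardE.
Qed.

Lemma card_or_inf_setT (T : finType) : card_or_inf [set: T] = Some #|T|.
Proof. by rewrite -card_or_inf_pred; congr card_or_inf; apply/seteqP; split. Qed.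

Lemma card_or_inf_infinite (T : choiceType) (A : set T) :
  infinite_set A -> card_or_inf A = None.
Proof. by move=> Ai; rewrite /card_or_inf asboolF. Qed.

(** The largest family is reached as soon as one model separates the expressions that
    describe all the others. *)
Lemma max_generated_by (n : nat) (I : set operation) (T : choiceType) (A : set T)
    (f : forall (X : topologicalType) (E : 'I_n -> set X), T -> set X) :
  (forall X E, space_generated I E = @f X E @` A) ->
  (exists X E, {in A &, injective (@f X E)}) ->
  max_generated n I (card_or_inf A).
Proof.
move=> fG [X [E fI]]; have GA := inj_card_eq fI.
rewrite -fG in GA; have {GA} := card_or_inf_eq GA.
rewrite {2 3}/card_or_inf; case: asboolP => [Af|_] GA; last by exists X, E.
split=> [|Y D]; first by exists X, E.
rewrite fG /card_or_inf asboolT; last exact: finite_image.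
exists #|` fset_set (f Y D @` A)| => //.
by rewrite fset_set_image//; exact: leq_imfset_card.
Qed.

Lemma max_generated_inf n (I : set operation) (X : topologicalType) (E : 'I_n -> set X) :
  infinite_set (space_generated I E) -> max_generated n I None.
Proof. by move=> Gi; exists X, E; exact: card_or_inf_infinite. Qed.

(** * Duality *)

Lemma closure_idem (X : topologicalType) (A : set X) : closure (closure A) = closure A.
Proof. by rewrite -(closure_id _).1//; exact: closed_closure. Qed.

Lemma interior_idem (X : topologicalType) (A : set X) : A°° = A°.
Proof. by rewrite (interior_id _).1//; exact: open_interior. Qed.

Definition dual_op (o : operation) : operation :=
  match o with
  | opK => opI | opI => opK | opC => opC | opMeet => opJoin | opJoin => opMeet
  end.

Lemma dual_opK : involutive dual_op. Proof. by case. Qed.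

Lemma op_closed_dual I (X : topologicalType) (S : set (set X)) :
  space_closed I S ->
  space_closed (dual_op @^-1` I) (setC @^-1` S).
Proof.
case=> Sk Si Sc Sm Sj; split=> IO A /=.
- by rewrite -interiorC; exact: Si.
- by rewrite -closure_setC; exact: Sk.
- exact: Sc.
- by move=> B SA SB; rewrite setCI; exact: Sj.
- by move=> B SA SB; rewrite setCU; exact: Sm.
Qed.

Lemma space_generated_dual I (X : topologicalType) n (E : 'I_n -> set X) :
  space_generated (dual_op @^-1` I) (fun j => ~` E j) = setC @` space_generated I E.
Proof.
apply: space_generatedE => [|j|A GA].
- have := op_closed_dual (generated_op_closed I E).
  by congr op_closed; apply/seteqP; split=> [A GA|_ [A GA <-]] /=;
    [exists (~` A); rewrite ?setCK | rewrite setCK].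
- by exists (E j) => //; exact: generator_generated.
suff : space_generated I E `<=` setC @^-1` space_generated (dual_op @^-1` I) (fun j => ~` E j).
  exact.
apply: smallest_sub => [|_ [j _ <-]]; last first.
  exact: (@generator_generated _ _ _ (fun j => ~` E j)).
have := op_closed_dual (generated_op_closed (dual_op @^-1` I) (fun j => ~` E j)).
by congr op_closed; apply/funext => o /=; rewrite dual_opK.
Qed.

(** Complementing the generators and dualizing the operations complements every generated
    set, so both families have the same cardinality. *)
Lemma max_generated_dual n I v :
  max_generated n I v -> max_generated n (dual_op @^-1` I) v.
Proof.
have dual_card (X : topologicalType) (E : 'I_n -> set X) :
    card_or_inf (space_generated (dual_op @^-1` I) (fun j => ~` E j)) =
    card_or_inf (space_generated I E).
  rewrite space_generated_dual; apply: card_or_inf_eq; apply: inj_card_eq => A B _ _.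
  exact: (can_inj setCK).
case: v => [m [[X [E GE]] le_m]|[X [E GE]]]; last first.
  by exists X, (fun j => ~` E j); rewrite dual_card.
split=> [|Y D]; first by exists X, (fun j => ~` E j); rewrite dual_card.
have [p Gp pm] := le_m Y (fun j => ~` D j); exists p => //.
rewrite -Gp -dual_card; congr (card_or_inf (space_generated _ _)).
by apply/funext => j; rewrite setCK.
Qed.

(** * Alexandrov spaces *)

(** A topology in which every point [x] has a least neighbourhood [N x]. *)
Section Alexandrov.
Variables (T : choiceType) (N : T -> set T).
Hypothesis Nxx : forall x, N x x.
Hypothesis N_sub : forall x y, N x y -> N y `<=` N x.

Definition alexandrov_points of (forall x, N x x) & (forall x y, N x y -> N y `<=` N x) :
  Type := T.
Local Notation points := (alexandrov_points Nxx N_sub).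

Let alexandrov_open : set (set T) := [set O | forall x, O x -> N x `<=` O].

Let openT : alexandrov_open setT. Proof. by []. Qed.

Let openI : setI_closed alexandrov_open.
Proof. by move=> A B oA oB x [Ax Bx] y xy; split; [exact: oA xy|exact: oB xy]. Qed.

Let open_bigU (J : Type) (f : J -> set T) :
  (forall i, alexandrov_open (f i)) -> alexandrov_open (\bigcup_i f i).
Proof. by move=> of_ x [i _ fix_] y xy; exists i => //; exact: of_ xy. Qed.

HB.instance Definition _ := Choice.copy points T.
HB.instance Definition _ :=
  isOpenTopological.Build points openT openI open_bigU.

Definition alexandrov : topologicalType := points.

Lemma nbhs_alexandrov (x : alexandrov) (A : set alexandrov) : nbhs x A <-> N x `<=` A.
Proof.
rewrite nbhsE; split=> [[B [oB Bx] BA]|NA].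
  by apply: subset_trans BA; exact: (oB x Bx).
exists (N x) => //; split=> //; exact: N_sub.
Qed.

Lemma interior_alexandrov (A : set alexandrov) : A° = [set x | N x `<=` A].
Proof. by apply/seteqP; split=> x /nbhs_alexandrov. Qed.

Lemma closure_alexandrov (A : set alexandrov) :
  closure A = [set x | exists2 y, A y & N x y].
Proof.
apply/seteqP; split=> [x cA|x [y Ay xy] B /nbhs_alexandrov NB].
  have /cA[y [Ay xy]] : nbhs (x : alexandrov) (N x) by apply/nbhs_alexandrov.
  by exists y.
by exists y; split=> //; exact: NB.
Qed.

End Alexandrov.

(** * Free closure algebras and their topological representation *)

Section PowerSetAlgebra.
Variable X : topologicalType.

Let closureUE (A B : set X) :
  Order.join (closure A) (closure B) = closure (Order.join A B).
Proof. by rewrite [RHS]closureU. Qed.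

Let le_closure (A : set X) : (A <= closure A :> set X)%O.
Proof. exact/SetOrder.Exports.subsetPset/subset_closure. Qed.

HB.instance Definition _ := @hasClosure.Build _ (set X) (@closure X)
  (@closure0 X) (@closure_idem X) le_closure closureUE.

Lemma algebra_generated_space I n (E : 'I_n -> set X) :
  algebra_generated I E = space_generated I E.
Proof.
rewrite /algebra_generated /space_generated.
have -> : @Order.compl _ (set X) = setC by apply/funext => A; exact: complEset.
have -> // : @inter _ (set X) = @interior X.
by apply/funext => A; rewrite /inter !complEset -interiorC setCK.
Qed.

End PowerSetAlgebra.

Lemma inter_hom d (A : closureAlgebraType d) d' (B : closureAlgebraType d') (f : A -> B) x :
  closure_algebra_hom f -> f (inter x) = inter (f x).
Proof. by case=> _ _ fc fk; rewrite /inter fc fk fc. Qed.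

(** Images and preimages of closed families under a homomorphism are closed. *)
Lemma algebra_generated_hom I n d (A : closureAlgebraType d) d' (B : closureAlgebraType d')
    (f : A -> B) (g : 'I_n -> A) :
  closure_algebra_hom f -> algebra_generated I (f \o g) = f @` algebra_generated I g.
Proof.
move=> fhom; have fi x := inter_hom x fhom; case: fhom => -[fm fj] _ fc fk.
rewrite eqEsubset; split.
  have [Gk Gi Gc Gm Gj] := smallest_op_closed (@clos d A) inter (@Order.compl d A)
    (@Order.meet d A) (@Order.join d A) I (range g).
  apply: smallest_sub => [|_ [j _ <-]]; last first.
    by exists (g j) => //; apply: sub_gen_smallest; exists j.
  split=> IO.
  - by move=> _ [x Gx <-]; rewrite -fk; exists (clos x) => //; exact: Gk.
  - by move=> _ [x Gx <-]; rewrite -fi; exists (inter x) => //; exact: Gi.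
  - by move=> _ [x Gx <-]; rewrite -fc; exists (Order.compl x) => //; exact: Gc.
  - by move=> _ _ [x Gx <-] [y Gy <-]; rewrite -fm; exists (Order.meet x y) => //; exact: Gm.
  - by move=> _ _ [x Gx <-] [y Gy <-]; rewrite -fj; exists (Order.join x y) => //; exact: Gj.
apply/image_subP; apply: smallest_sub => [|_ [j _ <-]]; last first.
  by apply: sub_gen_smallest; exists j.
have [Gk Gi Gc Gm Gj] := smallest_op_closed (@clos d' B) inter (@Order.compl d' B)
  (@Order.meet d' B) (@Order.join d' B) I (range (f \o g)).
split=> IO x /= => [Gx|Gx|Gx|y Gx Gy|y Gx Gy].
- by rewrite fk; exact: Gk.
- by rewrite fi; exact: Gi.
- by rewrite fc; exact: Gc.
- by rewrite fm; exact: Gm.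
- by rewrite fj; exact: Gj.
Qed.

Section Ultrafilters.
Variables (d : Order.disp_t) (A : closureAlgebraType d).
Local Open Scope order_scope.
Implicit Types (x y : A).

(** Ultrafilters of [A], presented as the Boolean homomorphisms from [A] to propositions. *)
Record ultrafilter := Ultrafilter {
  ultra_set :> A -> Prop;
  ultra_meet : forall x y, ultra_set (x `&` y) <-> ultra_set x /\ ultra_set y;
  ultra_compl : forall x, ultra_set (~` x) <-> ~ ultra_set x }.

Let proper_filter (q : set A) := [/\ forall x y, q x -> x <= y -> q y,
  forall x y, q x -> q y -> q (x `&` y) & ~ q \bot].

(** Zorn's lemma extends the principal filter of [a] to a maximal proper filter, and
    maximality forces it to decide every element. *)
Lemma ultrafilter_exists (a : A) : a != \bot -> exists p : ultrafilter, p a.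
Proof.
move=> a0; pose F := [set x | a <= x].
(* [F] is added to the sets of the chain so that the empty chain is covered. *)
have [F' FF' F'F] : exists2 q, proper_filter q /\ q a &
    forall q', proper_filter q' -> q `<=` q' -> q' `<=` q.
  pose P S := proper_filter (S `|` F).
  have [C CP Ctot|S [SP Smax]] := @Zorn_bigcup A P.
    have dir x y : (\bigcup_(S in C) S `|` F) x -> (\bigcup_(S in C) S `|` F) y ->
        exists2 S, (C S \/ S = F) & (S `|` F) x /\ (S `|` F) y.
      case=> [[S CS Sx]|Fx] [[S' CS' S'y]|Fy].
      - have [SS'|S'S] := Ctot _ _ CS CS'.
          by exists S'; [left|split; left => //; exact: SS'].
        by exists S; [left|split; left => //; exact: S'S].
      - by exists S; [left|split; [left|right]].
      - by exists S'; [left|split; [right|left]].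
      - by exists F; [right|split; right].
    have PF : proper_filter F.
      split=> [x y ax xy|x y ax ay|/= a0']; first exact: le_trans ax xy.
        by rewrite /F /= lexI ax ay.
      by move: a0; rewrite -lex0 a0'.
    have sub S : C S \/ S = F -> proper_filter (S `|` F) /\
        S `|` F `<=` \bigcup_(S in C) S `|` F.
      case=> [CS|->]; [split; first exact: CP|split; first by rewrite setUid].
        by move=> x [Sx|Fx]; [left; exists S|right].
      by move=> x [?|?]; right.
    split=> [x y Qx xy|x y Qx Qy|Q0].
    - by have [S /sub[[up _ _] SQ] [Sx _]] := dir x x Qx Qx; apply/SQ/(up x).
    - by have [S /sub[[_ me _] SQ] [Sx Sy]] := dir x y Qx Qy; apply/SQ/me.
    - by have [S /sub[[_ _ no] SQ] [S0 _]] := dir _ _ Q0 Q0.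
  exists (S `|` F); first by split=> //; right; rewrite /F /= lexx.
  move=> q qP Sq; apply: contrapT => nSq.
  apply: (Smax q); last by rewrite /P setUidl// => x Fx; apply: Sq; right.
  split; first by move=> x Sx; apply: Sq; left.
  by apply: contra_not nSq => qS x /qS; left.
have [[up me no] Fa] := FF'.
have F'I x y : F' (x `&` y) <-> F' x /\ F' y.
  by split=> [xy|[]]; [split; apply: up xy _; rewrite ?leIl ?leIr|exact: me].
suff F'C x : F' (~` x) <-> ~ F' x by exists (Ultrafilter F'I F'C).
split=> [F'c F'x|nF'x]; first by apply: no; rewrite -(meetxC x); exact: me.
apply: contrapT => nF'c; apply: nF'x.
(* As the complement of [x] is not in the filter, adjoining [x] keeps the filter proper. *)
apply: (F'F [set y | exists2 z, F' z & z `&` x <= y]); first last.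
- by exists a => //=; rewrite leIr.
- by move=> z F'z; exists z => //=; rewrite leIl.
split=> [y y' [z F'z zy] yy'|y y' [z F'z zy] [z' F'z' zy']|[z F'z]].
- by exists z => //; exact: le_trans yy'.
- exists (z `&` z'); first exact: me.
  by rewrite lexI (le_trans _ zy) ?(le_trans _ zy')// leI2// ?leIl ?leIr.
- by rewrite lex0 disj_leC => zx; apply: nF'c; exact: up zx.
Qed.

Lemma ultra_le (p : ultrafilter) x y : x <= y -> p x -> p y.
Proof. by move=> /meet_idPl <- /ultra_meet[]. Qed.

Lemma ultra_join (p : ultrafilter) x y : p (x `|` y) <-> p x \/ p y.
Proof.
split=> [|[]]; [|exact: ultra_le (leUl _ _)|exact: ultra_le (leUr _ _)].
move=> pxy; apply: contrapT => /not_orP[/ultra_compl px /ultra_compl py].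
have /ultra_compl : p (~` (x `|` y)) by rewrite complU; exact/ultra_meet.
exact.
Qed.

HB.instance Definition _ := gen_eqMixin ultrafilter.
HB.instance Definition _ := gen_choiceMixin ultrafilter.

(** The image of [a] under the Stone representation. *)
Definition stone_set (a : A) : set ultrafilter := [set p | ultra_set p a].

(** If [x] is not below [y], some ultrafilter contains [x] and the complement of [y]. *)
Lemma stone_set_inj : injective stone_set.
Proof.
move=> x y xy; apply/eqP; rewrite eq_le; apply/andP.
suff le_stone u v : stone_set u `<=` stone_set v -> u <= v.
  by split; apply: le_stone; rewrite xy.
move=> uv; apply: contrapT => /negP; rewrite -[v]complK -disj_leC.
by move=> /ultrafilter_exists[p /ultra_meet[/uv pv /ultra_compl]].
Qed.

Lemma interI x y : inter x `&` inter y = inter (x `&` y).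
Proof. by rewrite /inter -complU closU complI. Qed.

Lemma inter1 : inter \top = \top :> A.
Proof. by rewrite /inter compl1 clos0 compl0. Qed.

(** Unlike in the Stone space of a Boolean algebra, only the sets of open elements are
    declared open, so that topological closure is the image of the operation [clos]. *)
Definition stone_open : set (set ultrafilter) :=
  [set O | forall p, O p -> exists2 x, stone_set (inter x) p & stone_set (inter x) `<=` O].

Let stone_openT : stone_open setT.
Proof.
move=> p _; exists \top => //; rewrite inter1 /stone_set/= -compl0.
by apply/ultra_compl => p0; apply/(ultra_compl p \bot): (p0); apply: ultra_le p0; rewrite le0x.
Qed.

Let stone_openI : setI_closed stone_open.
Proof.
move=> O O' oO oO' p [/oO[x px xO] /oO'[y py yO']]; exists (x `&` y).
  by rewrite -interI; apply/ultra_meet.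
by rewrite -interI => q /ultra_meet[/xO ? /yO'].
Qed.

Let stone_open_bigU (J : Type) (O : J -> set ultrafilter) :
  (forall j, stone_open (O j)) -> stone_open (\bigcup_j O j)%classic.
Proof.
move=> oO p [j _ /(oO j)[x px xO]]; exists x => // q /xO; by exists j.
Qed.

HB.instance Definition _ :=
  isOpenTopological.Build ultrafilter stone_openT stone_openI stone_open_bigU.

Definition stone_space : topologicalType := ultrafilter.

(** A basic neighbourhood given by an open element misses [a] exactly when it misses
    [clos a], and the complement of [clos a] is such an open element. *)
Lemma closure_stone_set (a : A) :
  closure (stone_set a : set stone_space) = stone_set (clos a).
Proof.
have closC x : ~` clos x = inter (~` x) by rewrite /inter complK.
apply/seteqP; split=> p.
  move=> cl_p; apply: contrapT => /ultra_compl; rewrite closC => p_ext.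
  have : nbhs (p : stone_space) (stone_set (inter (~` a))).
    have ext_open : stone_open (stone_set (inter (~` a))) by move=> q qa; exists (~` a).
    by rewrite nbhsE; exists (stone_set (inter (~` a))).
  move=> /cl_p[q [qa]]; rewrite /stone_set /= -closC => /ultra_compl; apply.
  exact: ultra_le (le_clos a) qa.
move=> pa B; rewrite nbhsE => -[O [oO /oO[x px xO]] OB].
have : inter x `&` a != \bot.
  rewrite meetC disj_leC /inter complK; apply/negP => ax.
  have : clos a <= clos (~` x).
    by move: ax; rewrite -{2}(closK (~` x)) !leEjoin closU => /eqP->.
  move=> /ultra_le/(_ pa) pcx.
  by move: px; rewrite /stone_set /= /inter => /ultra_compl; exact.
move=> /ultrafilter_exists[q /ultra_meet[qx qa]].
by exists q; split => //; apply/OB/xO.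
Qed.

Lemma stone_set_hom : closure_algebra_hom (stone_set : A -> set stone_space).
Proof.
split; [split| split | |].
- by move=> x y; apply/seteqP; split=> p /ultra_meet.
- by move=> x y; apply/seteqP; split=> p /ultra_join.
- apply/seteqP; split=> // p p0; apply/(ultra_compl p \bot): (p0).
  by apply: ultra_le p0; rewrite le0x.
- apply/seteqP; split=> // p _; have [x px _] := stone_openT (I : setT p).
  exact: ultra_le (lex1 _) px.
- by move=> x; rewrite SetOrder.Exports.complEset; apply/seteqP; split=> p /ultra_compl.
- by move=> x; exact/esym/closure_stone_set.
Qed.

End Ultrafilters.

(** The free algebra is itself represented by a space, and every other choice of sets in
    a space is the image of that generic one under a homomorphism. *)
Lemma max_generated_free n (I : set operation) d (F : closureAlgebraType d)
    (g : 'I_n -> F) :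
  free_closure_algebra g -> max_generated n I (card_or_inf (algebra_generated I g)).
Proof.
move=> freeF.
pose f (X : topologicalType) (E : 'I_n -> set X) := sval (cid (freeF _ (set X) E)).
have fP (X : topologicalType) E : closure_algebra_hom (@f X E) /\ @f X E \o g = E.
  by rewrite /f; case: cid => /= h [[h1 h2] _]; split=> //; apply/funext.
apply: (max_generated_by (f := f)) => [X E|].
  have [fhom fE] := fP X E.
  by rewrite -algebra_generated_space -{1}fE; exact: algebra_generated_hom.
exists (stone_space F), (fun j => stone_set (g j)) => x y _ _.
rewrite /f; case: cid => h [_ h_uniq] /=.
by rewrite (h_uniq _ (conj (@stone_set_hom _ F) (fun=> erefl))); exact: stone_set_inj.
Qed.

(** * Words in closure, interior and complement *)

Definition op_code (o : operation) : nat :=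
  match o with opK => 0 | opI => 1 | opC => 2 | opMeet => 3 | opJoin => 4 end.

Definition op_decode (m : nat) : operation := nth opK [:: opK; opI; opC; opMeet; opJoin] m.

Lemma op_codeK : cancel op_code op_decode. Proof. by case. Qed.

HB.instance Definition _ := Equality.copy operation (can_type op_codeK).

Definition is_unary (o : operation) := o \in [:: opK; opI; opC].

Section Words.
Variable X : topologicalType.

Definition unary_op (o : operation) : set X -> set X :=
  match o with opK => @closure X | opI => @interior X | opC => setC | _ => id end.

Definition word_eval (w : seq operation) (A : set X) : set X := foldr unary_op A w.

End Words.

Definition pushK (w : seq operation) :=
  match w with
  | opK :: _ => w
  | opI :: opK :: opI :: w' => opK :: opI :: w'
  | _ => opK :: w
  end.

Definition pushI (w : seq operation) :=
  match w with
  | opI :: _ => w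
  | opK :: opI :: opK :: w' => opI :: opK :: w'
  | _ => opI :: w
  end.

(** Kuratowski's reductions: complements move to the front, repeated letters merge, and
    [kiki = ki], [ikik = ik]. *)
Definition push (o : operation) (w : seq operation) :=
  match o, w with
  | opC, opC :: w' => w'
  | opC, _ => opC :: w
  | opK, opC :: w' => opC :: pushI w'
  | opK, _ => pushK w
  | opI, opC :: w' => opC :: pushK w'
  | opI, _ => pushI w
  | _, _ => w
  end.

Section Words.
Variable X : topologicalType.
Implicit Types A : set X.

Lemma word_eval_pushK w A : word_eval (pushK w) A = closure (word_eval w A).
Proof.
case: w => [|[] [|[] [|[] w]]] //=; rewrite ?closure_idem//.
exact/esym/closure_interior_idem.
Qed.

Lemma word_eval_pushI w A : word_eval (pushI w) A = (word_eval w A)°.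
Proof.
case: w => [|[] [|[] [|[] w]]] //=; rewrite ?interior_idem//.
exact/esym/interior_closure_idem.
Qed.

Lemma word_eval_push o w A : word_eval (push o w) A = unary_op o (word_eval w A).
Proof.
case: o w => -[|[] w] //=;
  rewrite ?word_eval_pushK ?word_eval_pushI ?closure_idem ?interior_idem ?setCK ?closure_setC
    ?interiorC //.
- exact: (word_eval_pushK (opI :: w)).
- exact: (word_eval_pushI (opK :: w)).
Qed.

End Words.

(** The separating space consists of copies of nine points in four blocks, each point
    having the least neighbourhood listed here: the indiscrete pair 0, 1; the Sierpinski
    spaces 2, 3 and 4, 5 with open points 2 and 4; and 6, 7, 8 where 8 lies in the closure
    of each of the open points 6 and 7. The remaining points are isolated. *)
Definition nbr (p : nat) : seq nat :=
  p :: nth [::] [:: [:: 1]; [:: 0]; [::]; [:: 2]; [::]; [:: 4]; [::]; [::]; [:: 6; 7]] p.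

(** Write [k] and [i] for closure and interior. The indiscrete pair separates the set from
    all images under nonempty words in [k] and [i], and [i], [ki], [iki] from [k], [ik],
    [kik]; the points 2 and 3 separate [k] from [ik] and [kik]; 4 and 5 separate [i] from
    [ki] and [iki]; the last block separates [ik] from [kik] and [iki] from [ki]. Since 6
    is an isolated point of the set and 7 an isolated point outside, no word gives the
    empty set or the whole space. *)
Definition nine_point_set : pred nat := mem [:: 0; 3; 4; 6].

Lemma nbr_trans p q : q \in nbr p -> {subset nbr q <= nbr p}.
Proof.
have [p9|p9] := ltnP p 9.
  have nbr_le9 : all (fun p => all (fun q => all (mem (nbr p)) (nbr q)) (nbr p)) (iota 0 9).
    by [].
  have /(allP nbr_le9)/allP nbr_p : p \in iota 0 9 by rewrite mem_iota.
  by move=> /nbr_p/allP.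
by rewrite /nbr nth_default// inE => /eqP-> r; rewrite nth_default.
Qed.

Definition bool_op (o : operation) (P : pred nat) : pred nat :=
  match o with
  | opK => fun p => has P (nbr p)
  | opI => fun p => all P (nbr p)
  | opC => predC P
  | _ => P
  end.

Definition bool_eval (w : seq operation) (P : pred nat) : pred nat := foldr bool_op P w.

Definition signature (w : seq operation) (P : pred nat) : seq bool :=
  [seq bool_eval w P p | p <- iota 0 9].

Section Copies.
Variable n : nat.

Let N (x : 'I_n * nat) : set ('I_n * nat) := [set y | y.1 = x.1 /\ y.2 \in nbr x.2].

Let Nxx x : N x x. Proof. by split=> //; rewrite inE eqxx. Qed.

Let N_sub x y : N x y -> N y `<=` N x.
Proof. by move=> [yx1 yx2] z [zy1 zy2]; split; [rewrite zy1|exact: nbr_trans zy2]. Qed.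

Definition copies : topologicalType := alexandrov Nxx N_sub.

Lemma word_eval_copies w (P : 'I_n -> pred nat) :
  word_eval w ([set x | P x.1 x.2] : set copies) = [set x | bool_eval w (P x.1) x.2].
Proof.
elim: w => //= o w ->; case: o => //=.
- rewrite closure_alexandrov; apply/seteqP; split=> -[l p] /=.
    move=> [[l' q] /= Pq [/= l'l qp]]; apply/(@hasP _ _ (nbr p)).
    by exists q; rewrite // -l'l.
  by move=> /(@hasP _ _ (nbr p))[q qp Pq]; exists (l, q).
- rewrite interior_alexandrov; apply/seteqP; split=> -[l p] /=.
    by move=> NP; apply/(@allP _ _ (nbr p)) => q qp; exact: (NP (l, q)).
  by move=> /(@allP _ _ (nbr p)) NP [l' q] [/= -> qp]; exact: NP.
- by apply/seteqP; split=> -[l p] /= /negP.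
Qed.

Definition copies_sets (j : 'I_n) : set copies :=
  [set x | (x.1 == j) && nine_point_set x.2].

Lemma word_eval_copies_sets w j (l : 'I_n) p :
  word_eval w (copies_sets j) (l, p) =
  bool_eval w (if l == j then nine_point_set else pred0) p :> Prop.
Proof.
rewrite /copies_sets (word_eval_copies w (fun l p => (l == j) && nine_point_set p)) /=.
by congr (is_true (bool_eval _ _ _)); apply/funext => q; case: eqP.
Qed.

End Copies.

(** In the copy of the nine points that belongs to another generator [copies_sets j] is
    empty, so the second condition tells words applied to different generators apart. *)
Definition separated (ws : seq (seq operation)) : bool :=
  uniq [seq signature w nine_point_set | w <- ws] &&
  all (fun w => signature w nine_point_set \notin [seq signature w' pred0 | w' <- ws]) ws.

Lemma signature_copies n (j j' l : 'I_n) w w' :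
  word_eval w (copies_sets j) = word_eval w' (copies_sets j') ->
  signature w (if l == j then nine_point_set else pred0) =
  signature w' (if l == j' then nine_point_set else pred0).
Proof.
move=> ww'; apply: eq_map => p; apply/idP/idP; rewrite -!word_eval_copies_sets ww' //.
Qed.

(** The words in [ws] act as a transversal of the monoid generated by the operations [us]:
    no others are needed, and the separating space tells all of them apart. *)
Lemma max_generated_unary n (us : seq operation) (ws : seq (seq operation)) :
  all is_unary us -> [::] \in ws -> all (all (mem us)) ws ->
  all (fun o => all (fun w => push o w \in ws) ws) us -> separated ws ->
  max_generated n [set` us] (Some (size ws * n)%N).
Proof.
move=> us_unary ws0 /allP ws_us /allP push_ws /andP[/uniqP sig_inj /allP sig_pred0].
have -> : Some (size ws * n)%N = card_or_inf [set: 'I_(size ws) * 'I_n].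
  by rewrite card_or_inf_setT card_prod !card_ord.
apply: (max_generated_by (f := fun (X : topologicalType) (E : 'I_n -> set X)
  (t : 'I_(size ws) * 'I_n) => word_eval (nth [::] ws t.1) (E t.2))); last first.
  exists (copies n), (@copies_sets n) => -[m j] [m' j'] _ _ /= mm'.
  have nth_ws (i : 'I_(size ws)) : nth [::] ws i \in ws by exact: mem_nth.
  have sig := signature_copies _ mm'.
  have jj' : j = j'.
    apply: contrapT => /eqP jj'; have := sig j; rewrite eqxx (negPf jj').
    move=> sj; have /negP := sig_pred0 _ (nth_ws m); rewrite sj; apply.
    exact: (map_f (fun w => signature w pred0)).
  congr pair => //; apply/val_inj/(sig_inj [::]); rewrite ?inE ?size_map ?ltn_ord//.
  have := sig j; rewrite -jj' eqxx.
  by rewrite -!(nth_map [::] [::] (fun w => signature w nine_point_set)) ?ltn_ord.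
move=> X E.
have evalP w j : w \in ws ->
    [set word_eval (nth [::] ws t.1) (E t.2) | t in [set: 'I_(size ws) * 'I_n]]
      (word_eval w (E j)).
  move=> wws; have iw : (index w ws < size ws)%N by rewrite index_mem.
  by exists (Ordinal iw, j) => //=; rewrite nth_index.
apply: space_generatedE => [|j|[m j] _ /=]; last 2 first.
- exact: (evalP [::]).
- have : nth [::] ws m \in ws by exact: mem_nth.
  move=> /ws_us; have [Gk Gi Gc _ _] := generated_op_closed [set` us] E.
  elim: (nth _ _ _) => [_|o w IHw /andP[o_us /IHw Gw]]; first exact: generator_generated.
  by case: o o_us => //= o_us; [exact: Gk|exact: Gi|exact: Gc].
have pushP o A : o \in us ->
    [set word_eval (nth [::] ws t.1) (E t.2) | t in [set: 'I_(size ws) * 'I_n]] A ->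
    [set word_eval (nth [::] ws t.1) (E t.2) | t in [set: 'I_(size ws) * 'I_n]]
      (unary_op o A).
  move=> /push_ws/allP push_o [[m j] _ <-] /=; rewrite -word_eval_push; apply: evalP.
  by apply: push_o; exact: mem_nth.
split=> IO; [move=> A; exact: (pushP opK)|move=> A; exact: (pushP opI)|
  move=> A; exact: (pushP opC)|..]; by have /(allP us_unary) := IO.
Qed.

(** The seven images of Kuratowski's theorem that need no complement. *)
Definition monotone_words : seq (seq operation) :=
  [:: [::]; [:: opK]; [:: opI]; [:: opK; opI]; [:: opI; opK];
      [:: opK; opI; opK]; [:: opI; opK; opI]].

Definition kuratowski_words : seq (seq operation) :=
  monotone_words ++ map (cons opC) monotone_words.

Lemma max_generated_none n : max_generated n [set` [::]] (Some n).
Proof. by rewrite -[n in Some n]mul1n; exact: (@max_generated_unary n _ [:: [::]]). Qed.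

Lemma max_generated_i n : max_generated n [set` [:: opI]] (Some (2 * n)%N).
Proof. exact: (@max_generated_unary n _ [:: [::]; [:: opI]]). Qed.

Lemma max_generated_c n : max_generated n [set` [:: opC]] (Some (2 * n)%N).
Proof. exact: (@max_generated_unary n _ [:: [::]; [:: opC]]). Qed.

Lemma max_generated_ik n : max_generated n [set` [:: opI; opK]] (Some (7 * n)%N).
Proof. exact: (@max_generated_unary n _ monotone_words). Qed.

Lemma max_generated_ikc n : max_generated n [set` [:: opI; opK; opC]] (Some (14 * n)%N).
Proof. exact: (@max_generated_unary n _ kuratowski_words). Qed.

(** * Families generated without topology *)

(** The discrete space of all truth assignments to [n] variables. *)
Section Assignments.
Variable n : nat.

Definition assignments : topologicalType :=
  @alexandrov {set 'I_n} (fun s => [set s]) (fun s => erefl s)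
    (fun s s' ss' => ltac:(by rewrite ss')).

Definition assignment_sets (j : 'I_n) : set assignments := [set s | j \in (s : {set 'I_n})].

End Assignments.

Section DistributiveTerms.
(* The lattice structure of the term model is attached to names of this module. *)
Import FreeDistrLattice.
Variables (n : nat) (d : Order.disp_t) (L : distrLatticeType d) (h : 'I_n -> L).
Local Open Scope order_scope.
Implicit Types (s t : FreeDistrLattice.term n) (e : {set 'I_n}) (w y z : L).

Let eval := FreeDistrLattice.eval h.
Let truth t : set (assignments n) := FreeDistrLattice.eval (@assignment_sets n) t.

Let le_eval w e t : (forall j, j \in e -> w <= h j) -> truth t e -> w <= eval t.
Proof.
move=> we; elim: t => [j|s IHs t IHt|s IHs t IHt] /=; first exact: we.
- by move=> [/IHs ws /IHt wt]; rewrite lexI ws.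
- by case=> [/IHs ws|/IHt wt]; [exact: le_trans ws (leUl _ _)|exact: le_trans wt (leUr _ _)].
Qed.

Let truthS e e' t : e \subset e' -> truth t e -> truth t e'.
Proof.
move=> /fintype.subsetP ee'; elim: t => [j|s IHs t IHt|s IHs t IHt]; first exact: ee'.
- by case=> /IHs ? /IHt ?; split.
- by case=> [/IHs|/IHt]; [left|right].
Qed.

(** This is the disjunctive normal form of [s] without its empty meets and joins: [w] stands
    for a lower bound of the generators that are true under [e]. The parameter [z] carries
    the other factor of a meet through the induction. *)
Let eval_le s : forall y z,
  (forall e w, truth s e -> (forall j, j \in e -> w <= h j) -> z `&` w <= y) ->
  z `&` eval s <= y.
Proof.
elim: s => [j|s IHs t IHt|s IHs t IHt] y z zy /=.
- by apply: (zy [set j]%SET) => [|i]; rewrite /truth/= /assignment_sets/= ?inE// => /eqP->.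
- rewrite meetA meetAC; apply: IHs => e w se we.
  rewrite meetAC; apply: IHt => e' w' te' we'; rewrite -meetA.
  apply: (zy (e :|: e')%SET) => [|j].
    by split; [apply: truthS se|apply: truthS te'];
      rewrite ?finset.subsetUl ?finset.subsetUr.
  by rewrite inE => /orP[/we|/we']; [exact/le_trans/leIl|exact/le_trans/leIr].
- rewrite meetUr leUx; apply/andP; split; [apply: IHs|apply: IHt] => e w se we.
    by apply: (zy e) => //; left.
  by apply: (zy e) => //; right.
Qed.

(** An inequality between lattice terms that holds for truth values holds in every
    distributive lattice. *)
Lemma truth_le s t : truth s `<=` truth t -> eval s <= eval t.
Proof.
move=> st; rewrite -[eval s]meetxx; apply: eval_le => e w se we.
by apply: le_trans (leIr _ _) _; apply: le_eval we _; exact: st.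
Qed.

Lemma truth_inj s t : truth s = truth t -> eval s = eval t.
Proof. by move=> st; apply: le_anti; rewrite !truth_le// st. Qed.

(** Mapping [L] to the term model and back fixes the generators, hence is the identity. *)
Lemma free_distr_lattice_terms : free_distr_lattice h -> forall x, exists t, x = eval t.
Proof.
move=> freeL x.
have [phi [[phim phij phih] _]] :=
  freeL _ _ (fun j => FreeDistrLattice.pi (FreeDistrLattice.Var j)).
have [psi [[psim psij psih] _]] := @FreeDistrLattice.free n _ L h.
have [f [_ f_uniq]] := freeL _ L h.
have fid : f = id by apply: f_uniq; split.
have fpsi : f = psi \o phi.
  apply: f_uniq; split=> [y z|y z|j] /=.
  - by rewrite phim psim.
  - by rewrite phij psij.
  - by rewrite phih psih.
have [t tx] := FreeDistrLattice.piP (phi x); exists t.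
rewrite -[x]/(id x) -fid fpsi /= -tx; elim: (t) => [j|s IHs u IHu|s IHs u IHu] /=.
- exact: psih.
- by rewrite -FreeDistrLattice.meetE psim IHs IHu.
- by rewrite -FreeDistrLattice.joinE psij IHs IHu.
Qed.

End DistributiveTerms.

Lemma max_generated_lattice n d (L : distrLatticeType d) (h : 'I_n -> L) :
  free_distr_lattice h ->
  max_generated n [set` [:: opMeet; opJoin]] (card_or_inf [set: L]).
Proof.
move=> freeL; have terms := free_distr_lattice_terms freeL.
pose f (X : topologicalType) (E : 'I_n -> set X) := sval (cid (freeL _ (set X) E)).
have fP (X : topologicalType) (E : 'I_n -> set X) : [/\ Order.meet_morphism (f X E),
    Order.join_morphism (f X E) & forall j, f X E (h j) = E j].
  by rewrite /f; case: cid => ? [].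
have f_eval (X : topologicalType) (E : 'I_n -> set X) t :
    f X E (FreeDistrLattice.eval h t) = FreeDistrLattice.eval E t.
  have [fm fj fE] := fP X E; elim: t => [j|s IHs t IHt|s IHs t IHt] /=; first exact: fE.
  - by rewrite fm IHs IHt.
  - by rewrite fj IHs IHt.
apply: (max_generated_by (f := f)) => [X E|].
  have [fm fj fE] := fP X E; apply: space_generatedE => [|j|x _].
  - split=> // _ _ _ [x _ <-] [y _ <-].
      by exists (Order.meet x y) => //; exact: fm.
    by exists (Order.join x y) => //; exact: fj.
  - by exists (h j).
  - have [_ _ _ Gm Gj] := generated_op_closed [set` [:: opMeet; opJoin]] E.
    have [t ->] := terms x; rewrite f_eval.
    elim: t => [j|s IHs t IHt|s IHs t IHt] /=; first exact: generator_generated.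
      exact: Gm.
    exact: Gj.
exists (assignments n), (@assignment_sets n) => x y _ _.
have [[s ->] [t ->]] := (terms x, terms y); rewrite !f_eval; exact: truth_inj.
Qed.

(** * Meets and Boolean combinations *)

(** Some index must be present: the family [S] need not contain the whole space, which is
    the empty meet. *)
Lemma finite_meet_closed (X : Type) (S : set (set X)) (J : finType) (D : pred J)
    (l : J -> set X) :
  (forall A B, S A -> S B -> S (A `&` B)) -> (exists j, D j) ->
  (forall j, D j -> S (l j)) -> S [set x | forall j, D j -> l j x].
Proof.
move=> SI [j0 Dj0] Sl.
have meet_seq (s : seq J) : {subset s <= D} ->
    S [set x | l j0 x /\ forall j, j \in s -> l j x].
  elim: s => [_|j s IHs sD].
    have -> : [set x | l j0 x /\ forall j, j \in [::] -> l j x] = l j0.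
      by apply/seteqP; split=> [x []|x].
    exact: Sl.
  have -> : [set x | l j0 x /\ forall i, i \in j :: s -> l i x] =
      l j `&` [set x | l j0 x /\ forall i, i \in s -> l i x].
    apply/seteqP; split=> [x [l0 ljs]|x [lj [l0 ls]]].
      split; first by apply: ljs; rewrite mem_head.
      by split=> // i si; apply: ljs; rewrite inE si orbT.
    by split=> // i; rewrite inE => /predU1P[->|/ls].
  by apply: SI; [apply/Sl/sD/mem_head|apply: IHs => i si; apply: sD; rewrite inE si orbT].
have := meet_seq (enum D) (fun j => ltac:(by rewrite mem_enum)).
congr S; apply/seteqP; split=> [x [_ lx] j Dj|x lx].
  by apply: lx; rewrite mem_enum.
by split=> [|j]; [exact: lx|rewrite mem_enum; exact: lx].
Qed.

(** Pairs [(l, b)], where [(l, true)] and [(l, false)] are topologically indistinguishable. *)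
Section Pairs.
Variable n : nat.

Definition pairs : topologicalType :=
  @alexandrov ('I_n * bool)%type (fun x => [set y | y.1 = x.1]) (fun x => erefl x.1)
    (fun x y xy => ltac:(by move: xy => /= ->)).

Definition pair_sets (j : 'I_n) : set pairs := [set x | (x.1 == j) ==> x.2].

Lemma interior_pair_sets j : (pair_sets j)° = [set x | x.1 != j].
Proof.
rewrite interior_alexandrov; apply/seteqP; split=> -[l b] /=.
  by move=> /(_ (l, false) erefl); rewrite /pair_sets /=; case: eqP.
by move=> lj [l' b'] /= ->; rewrite /pair_sets /= (negPf lj).
Qed.

End Pairs.

Lemma max_generated_meet n : max_generated n [set` [:: opMeet]] (Some (2 ^ n - 1)%N).
Proof.
pose A := [set s : {set 'I_n} | s != finset.set0].
have -> : Some (2 ^ n - 1)%N = card_or_inf A.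
  rewrite (card_or_inf_pred (predC1 finset.set0)) cardC1 subn1.
  by have /= := card_powerset [set: 'I_n]%SET; rewrite powersetT cardsT cardsT card_ord => ->.
apply: (max_generated_by (f := fun (X : topologicalType) (E : 'I_n -> set X)
  (s : {set 'I_n}) => [set x | forall j, j \in s -> E j x])) => [X E|].
  apply: space_generatedE => [|j|s /set0Pn s0]; last 1 first.
  - apply: (@finite_meet_closed _ _ _ (mem s)) => // [|j _]; last exact: generator_generated.
    by have [_ _ _ Gm _] := generated_op_closed [set` [:: opMeet]] E; exact: Gm.
  - split=> // _ _ _ [s s0 <-] [t t0 <-]; exists (s :|: t)%SET.
      rewrite /A/=; apply: contra_neq s0 => st0; apply/eqP; rewrite -finset.subset0 -st0.
      exact: finset.subsetUl.
    apply/seteqP; split=> [x st|x [sx tx] j].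
      by split=> j js; apply: st; rewrite inE js ?orbT.
    by rewrite inE => /orP[/sx|/tx].
  - exists [set j]%SET; first by apply/set0Pn; exists j; rewrite inE.
    by apply/seteqP; split=> [x|x Ex i]; [apply; rewrite inE|rewrite inE => /eqP->].
exists (pairs n), (@pair_sets n) => s t _ _ st; apply/finset.setP => j.
have mem_pair (u : {set 'I_n}) :
    (forall i, i \in u -> pair_sets i (j, false)) <-> j \notin u.
  split=> [ju|ju i iu]; first by apply/negP => /ju; rewrite /pair_sets/= eqxx.
  by rewrite /pair_sets/= implybF; apply: contraNneq ju => ->.
have /(congr1 (fun S => S (j, false))) /= st' := st.
by apply: negb_inj; apply/idP/idP => /mem_pair; [rewrite st'|rewrite -st'] => /mem_pair.
Qed.

(** A meet may use [E j], its interior, or neither; using both amounts to using the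
    interior, which makes three choices for each generator. *)
Definition literal (X : topologicalType) (A : set X) (o : option bool) : set X :=
  match o with None => setT | Some false => A | Some true => A° end.

Definition literal_meet n (X : topologicalType) (E : 'I_n -> set X)
    (f : {ffun 'I_n -> option bool}) : set X :=
  [set x | forall j, literal (E j) (f j) x].

(** Interior commutes with finite meets, so taking the interior turns every literal into
    an interior. *)
Lemma interior_literal_meet n (X : topologicalType) (E : 'I_n -> set X) f :
  (literal_meet E f)° = literal_meet E [ffun j => omap xpredT (f j)].
Proof.
apply/seteqP; split=> x /= fx.
  move=> j; rewrite ffunE; case fj : (f j) => [b|//] /=.
  apply: filterS fx => y /(_ j); rewrite fj; case: b {fj} => //.
  exact: interior_subset.
apply: filter_forall => j; have := fx j; rewrite ffunE; case: (f j) => [[]|] /= ?.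
- exact: nbhs_interior.
- by [].
- exact: filterT.
Qed.

Lemma literalI (X : topologicalType) (A : set X) o o' :
  literal A o `&` literal A o' =
  literal A (match o, o' with
             | Some b, Some b' => Some (b || b') | Some b, None => Some b | None, _ => o' end).
Proof.
have AI : A° `<=` A := @interior_subset _ A.
by case: o o' => [[]|] [[]|] //=; rewrite ?setIid ?setTI ?setIT//;
  apply/setIidPl || apply/setIidPr.
Qed.

Lemma max_generated_i_meet n : max_generated n [set` [:: opI; opMeet]] (Some (3 ^ n - 1)%N).
Proof.
pose A := [set f : {ffun 'I_n -> option bool} | f != [ffun=> None]].
have -> : Some (3 ^ n - 1)%N = card_or_inf A.
  rewrite (card_or_inf_pred (predC1 [ffun=> None])) cardC1 subn1.
  by rewrite card_ffun card_option card_bool card_ord.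
have A_ex (f : {ffun 'I_n -> option bool}) j b : f j = Some b -> A f.
  by move=> fj; apply/eqP => f0; move: fj; rewrite f0 ffunE.
have ex_A (f : {ffun 'I_n -> option bool}) : A f -> exists j, f j != None.
  move=> /eqP f0; apply: contrapT => /forallNP fN; apply: f0; apply/ffunP => j.
  by rewrite ffunE; have /negP := fN j; rewrite negbK => /eqP.
apply: (max_generated_by (f := @literal_meet n)) => [X E|].
  apply: space_generatedE => [|j|f /ex_A f0]; last 1 first.
  - have [_ Gi _ Gm _] := generated_op_closed [set` [:: opI; opMeet]] E.
    have -> : literal_meet E f = [set x | forall j, f j != None -> literal (E j) (f j) x].
      apply/seteqP; split=> [x fx j _|x fx j]; first exact: fx.
      by have := fx j; case: (f j) => // a; apply.
    apply: (@finite_meet_closed _ _ _ (fun j => f j != None)) => // [|j]; first exact: Gm.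
    by case: (f j) => // -[_|_]; [apply: Gi => //|]; exact: generator_generated.
  - split=> // [_ _ [f /ex_A[j fj] <-]|_ _ _ [f /ex_A[j fj] <-] [g _ <-]].
      rewrite interior_literal_meet; exists [ffun j => omap xpredT (f j)] => //.
      by case fjE : (f j) fj => [b|//] _; apply: (A_ex _ j true); rewrite ffunE fjE.
    exists [ffun j => match f j, g j with
      | Some b, Some b' => Some (b || b') | Some b, None => Some b | None, _ => g j end].
      case fjE : (f j) fj => [b|//] _; case gj : (g j) => [b'|].
        by apply: (A_ex _ j (b || b')); rewrite ffunE fjE gj.
      by apply: (A_ex _ j b); rewrite ffunE fjE gj.
    apply/seteqP; split=> [x fgx|x [fx gx] j'].
      by split=> j'; have := fgx j'; rewrite ffunE -literalI => -[].
    by rewrite ffunE -literalI; split; [exact: fx|exact: gx].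
  - exists [ffun i => if i == j then Some false else None].
      by apply: (A_ex _ j false); rewrite ffunE eqxx.
    apply/seteqP; split=> [x /(_ j)|x Ex i]; first by rewrite ffunE eqxx.
    by rewrite ffunE; case: eqP => [->|].
exists (pairs n), (@pair_sets n) => f g _ _ fg; apply/ffunP => j.
(* The two points over [j] tell the three possible literals apart. *)
pose value (o : option bool) b := if o is Some c then ~~ c && b else true.
have at_j (u : {ffun 'I_n -> option bool}) b :
    literal_meet (@pair_sets n) u (j, b) <-> value (u j) b.
  split=> [/(_ j)|uj i].
    by case: (u j) => [[]|] //=; rewrite ?interior_pair_sets /pair_sets /= eqxx.
  have [->|ij] := eqVneq i j.
    by case: (u j) uj => [[]|] //= bT; rewrite /pair_sets /= eqxx.
  case: (u i) => [[]|] //=; rewrite ?interior_pair_sets /pair_sets /= eq_sym //.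
  by rewrite (negPf ij).
have fgb b : value (f j) b = value (g j) b.
  by apply/idP/idP => /at_j; [rewrite fg|rewrite -fg] => /at_j.
by move: (fgb true) (fgb false); case: (f j) (g j) => [[]|] [[]|].
Qed.

(** The generated sets are the unions of atoms, and assigning to a point the set of the
    generators that contain it identifies atoms with subsets of the index set. *)
Lemma max_generated_boolean n : (0 < n)%N ->
  max_generated n [set` [:: opC; opMeet; opJoin]] (Some (2 ^ (2 ^ n))%N).
Proof.
move=> n_gt0; pose j0 : 'I_n := Ordinal n_gt0.
have -> : Some (2 ^ (2 ^ n))%N = card_or_inf [set: {set {set 'I_n}}].
  have card_set (T : finType) : #|{set T}| = (2 ^ #|T|)%N.
    by rewrite -!cardsT -powersetT card_powerset.
  by rewrite card_or_inf_setT !card_set card_ord.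
(* A point of a space is described by the set of generators that contain it. *)
pose type_of (X : topologicalType) (E : 'I_n -> set X) x := [set j | `[< E j x >]]%SET.
apply: (max_generated_by (f := fun (X : topologicalType) (E : 'I_n -> set X)
  (D : {set {set 'I_n}}) => [set x | type_of X E x \in D])) => [X E|]; last first.
  exists (assignments n), (@assignment_sets n) => D D' _ _ DD'; apply/finset.setP => s.
  have type_ofE t : type_of _ (@assignment_sets n) t = t.
    by apply/finset.setP => j; rewrite inE; apply/asboolP/idP.
  have := congr1 (fun S => S s) DD'; rewrite /= type_ofE => DsD's.
  by apply/idP/idP; rewrite DsD's.
have [_ _ Gc Gm Gj] := generated_op_closed [set` [:: opC; opMeet; opJoin]] E.
apply: space_generatedE => [|j|D _].
- split=> // [_ _ [D _ <-]|_ _ _ [D _ <-] [D' _ <-]|_ _ _ [D _ <-] [D' _ <-]].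
  + by exists (~: D)%SET => //; apply/seteqP; split=> x /=; rewrite finset.inE; move/negP.
  + exists (D :&: D')%SET => //; apply/seteqP; split=> x /=; rewrite inE; first by move/andP.
    by move=> [-> ->].
  + exists (D :|: D')%SET => //; apply/seteqP; split=> x /=; rewrite inE; first by move/orP.
    by case=> ->; rewrite ?orbT.
- by exists [set s : {set 'I_n} | j \in s]%SET => //; apply/seteqP; split=> x /=;
    rewrite /type_of !finset.inE; move/asboolP.
(* Every set of descriptions gives a finite union of atoms, that is, the complement of a
   finite meet of complements. *)
have atom s : space_generated [set` [:: opC; opMeet; opJoin]] E [set x | type_of X E x = s].
  have -> : [set x | type_of X E x = s] =
      [set x | forall j, xpredT j -> (if j \in s then E j else ~` E j) x].
    apply/seteqP; split=> x.
      by move=> /= <- j _; rewrite inE; case: asboolP.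
    move=> xs; apply/finset.setP => j; rewrite inE.
    by have /= := xs j isT; case: ifP => _ ?; [rewrite asboolT|rewrite asboolF].
  apply: finite_meet_closed; first exact: Gm.
    by exists j0.
  move=> j _; case: ifP => _; last apply: (Gc isT); exact: generator_generated.
have -> : [set x | type_of X E x \in D] =
    ~` [set x | forall s, xpredT s -> (~` [set x | s \in D /\ type_of X E x = s]) x].
  apply/seteqP; split=> x /=; first by move=> xD /(_ (type_of X E x) isT); apply.
  by apply: contra_notP => xD s _ [sD xs]; apply: xD; rewrite xs.
apply: (Gc isT); apply: finite_meet_closed; first exact: Gm.
  by exists finset.set0.
move=> s _; apply: (Gc isT); have [sD|sD] := boolP (s \in D).
  by have := atom s; congr space_generated; apply/seteqP; split=> x /=; [|case].
have -> : [set x | false /\ type_of X E x = s] = E j0 `&` ~` E j0.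
  by rewrite setICr; apply/seteqP; split=> x // -[].
by apply: (Gm isT); [|apply: (Gc isT)]; exact: generator_generated.
Qed.

(** * Infinite families *)

(** The natural numbers, where the closed sets are the up-closed ones. *)
Definition upper_nat : topologicalType :=
  @alexandrov nat (fun m => [set p | (p <= m)%N]) leqnn
    (fun m p pm q qp => leq_trans qp pm).

Definition parity_sets n (j : 'I_n) : set upper_nat := [set m | odd m == (j != 0 :> nat)].

(** Closure turns the numbers of one parity from [m] on into all numbers from [m] on, and
    meeting those with the other parity leaves out [m]; the tails obtained are distinct. *)
Lemma max_generated_infinite n (I : set operation) :
  (2 <= n)%N -> I opK -> I opMeet -> max_generated n I None.
Proof.
move=> n2 IK IM; apply: (@max_generated_inf _ _ upper_nat (@parity_sets n)) => Gfin.
have [Gk _ _ Gm _] := generated_op_closed I (@parity_sets n).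
pose tail m : set upper_nat := [set p | (m <= p)%N && (odd p == odd m)].
have Gtail m : space_generated I (@parity_sets n) (tail m).
  pose j (b : bool) : 'I_n := Ordinal (leq_trans (leq_b1 b : b < 2)%N n2).
  have parityE b : parity_sets (j b) = [set p | odd p == b].
    by apply/seteqP; split=> p; rewrite /parity_sets /=; case: b.
  elim: m => [|m IHm].
    have -> : tail 0 = parity_sets (j false) by rewrite parityE.
    exact: generator_generated.
  have -> : tail m.+1 = closure (tail m) `&` parity_sets (j (odd m.+1)).
    rewrite parityE closure_alexandrov; apply/seteqP; split=> p /=.
      move=> /andP[mp /eqP pm]; split; last exact/eqP.
      by exists m; [rewrite /tail /= leqnn eqxx|exact: ltnW].
    move=> [[q /andP[mq _] qp] /eqP pm].
    rewrite /tail /= pm eqxx andbT ltn_neqAle (leq_trans mq qp) andbT.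
    by apply/eqP => mp; move: pm; rewrite -mp /=; case: odd.
  by apply: (Gm IM); [exact: (Gk IK)|exact: generator_generated].
have tail_inj : injective tail.
  move=> m p mp; apply/eqP; rewrite eqn_leq; apply/andP; split.
    suff /andP[] : tail m p by [].
    by rewrite mp /tail /= leqnn eqxx.
  suff /andP[] : tail p m by [].
  by rewrite -mp /tail /= leqnn eqxx.
apply: infinite_nat; rewrite (_ : setT = tail @^-1` space_generated I (@parity_sets n)).
  by apply: finite_preimage => // ? ? _ _; exact: tail_inj.
by apply/seteqP; split=> m // _; exact: Gtail.
Qed.

(** * The table *)

Lemma max_generated_equiv n I J v :
  (forall (X : topologicalType) (S : set (set X)),
     space_closed I S <-> space_closed J S) ->
  max_generated n I v -> max_generated n J v.
Proof.
move=> IJ; suff GE (X : topologicalType) (E : 'I_n -> set X) :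
    space_generated J E = space_generated I E.
  case: v => [m [[X [E GI]] le_m]|[X [E GI]]]; last by exists X, E; rewrite GE.
  by split=> [|Y D]; [exists X, E|]; rewrite GE.
congr (smallest _ _).
by apply/funext => S; apply/propext; have [] := IJ X S; split.
Qed.

Lemma max_generated_eq_seq n (I : set operation) (us : seq operation) v :
  (forall o, I o <-> o \in us) -> max_generated n [set` us] v -> max_generated n I v.
Proof. by move=> Ius; rewrite (_ : I = [set` us]) //; apply/seteqP; split=> o /Ius. Qed.

Lemma max_generated_dual_seq n (us : seq operation) v :
  max_generated n [set` us] v -> max_generated n [set` map dual_op us] v.
Proof.
move=> /max_generated_dual; congr max_generated; apply/funext => o /=.
by rewrite -{2}(dual_opK o) mem_map //; exact: can_inj dual_opK.
Qed.

Lemma op_closed_sub (X : topologicalType) (I J : set operation) (S : set (set X)) :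
  J `<=` I -> space_closed I S -> space_closed J S.
Proof. by move=> JI [Sk Si Sc Sm Sj]; split=> /JI. Qed.

(** A family that is closed under complements is closed under the duals of its
    operations. *)
Lemma max_generated_complement n (I : set operation) v :
  I opC -> max_generated n (I `|` dual_op @^-1` I) v -> max_generated n I v.
Proof.
move=> IC; apply: max_generated_equiv => X S; split=> [|SI].
  by apply: op_closed_sub => o; left.
have SC : setC @^-1` S = S.
  have [_ _ Sc _ _] := SI; apply/seteqP; split=> A /=; last exact: Sc.
  by move=> /(Sc IC); rewrite setCK.
have := op_closed_dual SI; rewrite SC => -[Sk' Si' Sc' Sm' Sj'].
by case: SI => Sk Si Sc Sm Sj; split=> -[]; auto.
Qed.

Ltac as_list us := apply: (@max_generated_eq_seq _ _ us);
  [by case; rewrite /= ?inE /=; intuition (by [])|].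

Theorem mainTheorem2 (n : nat) (hn : (2 <= n)%N)
    (dF : Order.disp_t) (F : closureAlgebraType dF) (g : 'I_n -> F)
    (hF : free_closure_algebra g)
    (dL : Order.disp_t) (L : distrLatticeType dL) (h : 'I_n -> L)
    (hL : free_distr_lattice h) :
  let Dn := card_or_inf [set: L] in
  let inf : option nat := None in
  (forall I : set operation, max_generated n I (card_or_inf (algebra_generated I g))) /\
  [/\ max_generated_row n set0
        (Some n) (Some (2 ^ n - 1)%N) (Some (2 ^ n - 1)%N) Dn,
      max_generated_row n [set opI]
        (Some (2 * n)%N) (Some (3 ^ n - 1)%N) inf inf,
      max_generated_row n [set opK]
        (Some (2 * n)%N) inf (Some (3 ^ n - 1)%N) inf,
      max_generated_row n [set opC]
        (Some (2 * n)%N) (Some (2 ^ (2 ^ n))%N) (Some (2 ^ (2 ^ n))%N)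
        (Some (2 ^ (2 ^ n))%N) &
      max_generated_row n [set opI; opK] (Some (7 * n)%N) inf inf inf /\
      [/\ max_generated_row n [set opI; opC] (Some (14 * n)%N) inf inf inf,
          max_generated_row n [set opK; opC] (Some (14 * n)%N) inf inf inf &
          max_generated_row n [set opI; opK; opC] (Some (14 * n)%N) inf inf inf]].
Proof.
move=> Dn inf; split=> [I|]; first exact: max_generated_free.
have boolean := max_generated_boolean (ltnW hn).
have kuratowski := max_generated_ikc n.
have infinite I := @max_generated_infinite n I hn.
have meets := max_generated_meet n.
have open_meets := max_generated_i_meet n.
split; [..|split; [|split]]; split.
- by as_list (Nil operation); exact: max_generated_none.
- by as_list [:: opMeet].
- by as_list [:: opJoin]; exact: (max_generated_dual_seq meets).
- by as_list [:: opMeet; opJoin]; exact: max_generated_lattice hL.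
- by as_list [:: opI]; exact: max_generated_i.
- by as_list [:: opI; opMeet].
- by as_list [:: opI; opJoin];
    apply: (@max_generated_dual_seq _ [:: opK; opMeet]); exact: infinite.
- by as_list [:: opI; opJoin; opMeet];
    apply: (@max_generated_dual_seq _ [:: opK; opMeet; opJoin]); exact: infinite.
- by as_list [:: opK]; exact: (max_generated_dual_seq (max_generated_i n)).
- by apply: infinite; [left|right].
- by as_list [:: opK; opJoin]; exact: (max_generated_dual_seq open_meets).
- by apply: infinite; [left|right; left].
- by as_list [:: opC]; exact: max_generated_c.
- by apply: max_generated_complement; [left|as_list [:: opC; opMeet; opJoin]].
- by apply: max_generated_complement; [left|as_list [:: opC; opMeet; opJoin]].
- by as_list [:: opC; opMeet; opJoin].
- by as_list [:: opI; opK]; exact: max_generated_ik.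
- by apply: infinite; [left; right|right].
- by as_list [:: opI; opK; opJoin];
    apply: (@max_generated_dual_seq _ [:: opK; opI; opMeet]); exact: infinite.
- by apply: infinite; [left; right|right; left].
- by apply: max_generated_complement; [left; right|as_list [:: opI; opK; opC]].
- apply: max_generated_complement; [by left; right|].
  by apply: infinite; [right; left; left|left; right].
- apply: max_generated_complement; [by left; right|].
  by apply: infinite; [right; left; left|right; right].
- apply: max_generated_complement; [by left; right|].
  by apply: infinite; [right; left; left|left; right; left].
- by apply: max_generated_complement; [left; right|as_list [:: opI; opK; opC]].
- by apply: infinite; [left; left|right].
- apply: max_generated_complement; [by left; right|].
  by apply: infinite; [left; left; left|right; right].
- by apply: infinite; [left; left|right; left].
- by as_list [:: opI; opK; opC].
- by apply: infinite; [left; left; right|right].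
- apply: max_generated_complement; [by left; right|].
  by apply: infinite; [left; left; left; right|right; right].
- by apply: infinite; [left; left; right|right; left].
Qed.
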